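(* Let $G$ and $H$ be two directed graphs on a vertex set $V$ of cardinality $n$. Let $A_1$ and $B_1$ be the Hermitian adjacency matrices of $G$ and $H$ respectively. Let $V_1, V_2, \ldots, V_p$ be disjoint subsets of $V$, and let $e_i \in \{0,1\}^V$ be the characteristic (column) vector of $V_i$. Define $J_{i,j} = e_i e_j^\top$ for $i,j = 1, 2, \ldots, p$, and let $k = 1 + p^2$. Let $\boldsymbol{A} = (A_1, J_{1,1}, J_{1,2}, \ldots, J_{p,p})$ and $\boldsymbol{B} = (B_1, J_{1,1}, J_{1,2}, \ldots, J_{p,p})$ be the $k$-tuples of $n \times n$ matrices consisting of $A_1$ (respectively $B_1$) followed by all the $J_{i,j}$, $1 \le i,j \le p$, in the same order. Then the matrices $W_{\boldsymbol{A}}(\boldsymbol{s})$ and $W_{\boldsymbol{B}}(\boldsymbol{s})$ have identically the same characteristic polynomials (that is, $\det(tI - W_{\boldsymbol{A}}(\boldsymbol{s})) = \det(tI - W_{\boldsymbol{B}}(\boldsymbol{s}))$ identically in $\boldsymbol{s}$ and $t$) if and only if they are similar via a fixed unitary matrix $Q$, independent of $\boldsymbol{s}$, such that $Q^\dagger A_1 Q = B_1$ and $Q^\dagger e_i = e_i$ for $i = 1, 2, \ldots, p$. Moreover, $Q^\dagger \widetilde{W}_{A_1} = \widetilde{W}_{B_1}$, where for an $n \times n$ matrix $A$ $$\widetilde{W}_{A} := [e_1, A e_1, \ldots, A^{n-1} e_1, e_2, A e_2, \ldots, A^{n-1} e_2, \ldots, e_p, A e_p, \ldots, A^{n-1} 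e_p].$$
   Context: A digraph (directed graph) $G$ is a pair $(V,E)$ with vertex set $V$ and directed edge set $E \subseteq \{(u,v) \in V \times V : u \neq v\}$. The Hermitian adjacency matrix of $G$ is the complex matrix $A_G$ indexed by $V$, where $\mathrm{i}$ denotes the imaginary unit, with $A_G(u,v) = 1$ if $(u,v) \in E$ and $(v,u) \in E$; $A_G(u,v) = \mathrm{i}$ if $(u,v) \in E$ and $(v,u) \notin E$; $A_G(u,v) = -\mathrm{i}$ if $(u,v) \notin E$ and $(v,u) \in E$; $A_G(u,v) = 0$ otherwise. For a $k$-tuple $\boldsymbol{A} = (M_1, \ldots, M_k)$ of $n \times n$ matrices and a $k$-tuple $\boldsymbol{s} = (s_1, \ldots, s_k)$ of complex variables, $W_{\boldsymbol{A}}(\boldsymbol{s}) = \sum_{i=1}^k s_i M_i$, and its characteristic polynomial is $\phi_{\boldsymbol{A}}(\boldsymbol{s};t) = \det(tI - W_{\boldsymbol{A}}(\boldsymbol{s}))$. ''Similar via $Q$'' means $Q^\dagger W_{\boldsymbol{A}}(\boldsymbol{s}) Q = W_{\boldsymbol{B}}(\boldsymbol{s})$ for all $\boldsymbol{s}$, where $Q^\dagger$ denotes the conjugate transpose of $Q$. *)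

(* Defs.v *)
From HB Require Import structures.
From mathcomp Require Import all_boot all_order all_algebra.
From mathcomp Require Import complex reals.

Set Implicit Arguments.
Unset Strict Implicit.
Unset Printing Implicit Defensive.

Import Order.TTheory GRing.Theory Num.Theory.

Local Open Scope ring_scope.
Local Open Scope sesquilinear_scope.

Record digraph (V : finType) := Digraph {
  edges : {set V * V};
  edges_loopless : forall u : V, (u, u) \notin edges
}.

(* Matrices and vectors indexed by a finite type V are represented with indices
   in 'I_#|V|, through the canonical enumeration enum_val : 'I_#|V| -> V. *)

Definition hermitian_adj (C : numClosedFieldType) (V : finType)
    (G : digraph V) : 'M[C]_#|V| :=
  \matrix_(a, b)
    let u := enum_val a in let v := enum_val b in
    match (u, v) \in edges G, (v, u) \in edges G with
    | true, true => 1
    | true, false => 'i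
    | false, true => - 'i
    | false, false => 0
    end.

Definition char_vec (C : numClosedFieldType) (V : finType) (S : {set V}) :
    'cV[C]_#|V| :=
  \col_a (enum_val a \in S)%:R.

Definition lin_pencil (C : numClosedFieldType) (n k : nat)
    (A : k.-tuple 'M[C]_n) (s : k.-tuple C) : 'M[C]_n :=
  \sum_(l < k) tnth s l *: tnth A l.

Definition pencil_char_poly (C : numClosedFieldType) (n k : nat)
    (A : k.-tuple 'M[C]_n) (s : k.-tuple C) (t : C) : C :=
  \det (t%:M - lin_pencil A s).

Definition similar_via (C : numClosedFieldType) (n k : nat)
    (A B : k.-tuple 'M[C]_n) (Q : 'M[C]_n) : Prop :=
  forall s : k.-tuple C, Q ^t* *m lin_pencil A s *m Q = lin_pencil B s.

Lemma extended_tupleP (C : numClosedFieldType) (n p : nat)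
    (M : 'M[C]_n) (e : 'I_p -> 'cV[C]_n) :
  size (M :: [seq e i *m (e j)^T | i <- enum 'I_p, j <- enum 'I_p])
    == (1 + p ^ 2)%N.
Proof. by rewrite /= size_allpairs size_enum_ord. Qed.

(* (M, J_11, J_12, ..., J_pp), the pairs (i, j) in lexicographic order. *)
Definition extended_tuple (C : numClosedFieldType) (n p : nat)
    (M : 'M[C]_n) (e : 'I_p -> 'cV[C]_n) : (1 + p ^ 2).-tuple 'M[C]_n :=
  Tuple (extended_tupleP M e).

(* [e_1, A e_1, ..., A^(n-1) e_1, ..., e_p, A e_p, ..., A^(n-1) e_p]; mxrow
   concatenates the p blocks, so there are \sum_(i < p) n = p * n columns. *)
Definition walk_matrix (C : numClosedFieldType) (n p : nat)
    (A : 'M[C]_n) (e : 'I_p -> 'cV[C]_n) : 'M[C]_(n, \sum_(i < p) n) :=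
  \mxrow_(i < p) \matrix_(a < n, m < n) (A ^+ m *m e i) a 0.

(* Main.v *)
Require Import Defs.
From HB Require Import structures.
From mathcomp Require Import all_boot all_order all_algebra all_fingroup.
From mathcomp Require Import complex reals.
From mathcomp Require Import ring.

Set Implicit Arguments.
Unset Strict Implicit.
Unset Printing Implicit Defensive.

Import Order.TTheory GRing.Theory Num.Theory.

Local Open Scope ring_scope.
Local Open Scope sesquilinear_scope.

(** Why the theorem holds.

Fix two Hermitian matrices A, B and vectors e_i.  Comparing the pencils at
coefficient 1 on the first matrix and 0 elsewhere shows that A and B have the
same spectrum d, so A = U^* D U and B = V^* D V with the same real diagonal
matrix D (hermitian_diagonalization_common).  Adding coefficient 1 on J_(i,j)
perturbs A by a matrix of rank one; by the matrix determinant lemma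
(det_sub_rank1) the equality of the perturbed determinants says that, away
from the spectrum, the resolvent entries e_j^* (t - A)^-1 e_i and
e_j^* (t - B)^-1 e_i coincide.

Move to eigencoordinates with the row vectors x_i = e_i^* U^* and
y_i = e_i^* V^*.  The resolvent entries are then rational functions of t with
simple poles at the entries of d, and comparing residues
(partial_fractions_eq0) shows that, for each eigenvalue l, the components of
the x_i on the coordinates of eigenvalue l have the same Gram matrix as those
of the y_i.  Vectors with the same Gram matrix are related by a unitary W, and
W can be chosen to commute with D because only eigenvectors for the same
eigenvalue are matched (exists_unitary_of_gram).  This W is built
one vector at a time from complex reflections, so no basis of an eigenspace or
of an orthogonal complement is ever needed.  Summing over the eigenvalues gives
x_i W = y_i, and Q = U^* W V is the required unitary
(hermitian_unitary_equiv).

Conversely, a unitary similarity of the pencils preserves determinants.  The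
identity between walk matrices is Q^* A^m e_i = (Q^* A Q)^m Q^* e_i, read
column by column. *)

(** * Conjugate transposes and unitary conjugation *)

Lemma trmxC_mul (C : numClosedFieldType) m n q (A : 'M[C]_(m, n))
    (B : 'M[C]_(n, q)) : (A *m B)^t* = B^t* *m A^t*.
Proof. by rewrite trmx_mul map_mxM. Qed.

Lemma trmxC_sub (C : numClosedFieldType) m n (A B : 'M[C]_(m, n)) :
  (A - B)^t* = A^t* - B^t*.
Proof. by rewrite linearB map_mxB. Qed.

Lemma trmxC_scale (C : numClosedFieldType) m n (a : C) (A : 'M[C]_(m, n)) :
  (a *: A)^t* = a^* *: A^t*.
Proof. by apply/matrixP => i j; rewrite !mxE rmorphM. Qed.

Lemma unitarymx_mulCmx (C : numClosedFieldType) n (Q : 'M[C]_n) :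
  Q \is unitarymx -> Q^t* *m Q = 1%:M.
Proof. by move=> /unitarymxP/mulmx1C. Qed.

Lemma det_unitary_conj (C : numClosedFieldType) n (Q M : 'M[C]_n) :
  Q \is unitarymx -> \det (Q^t* *m M *m Q) = \det M.
Proof.
move=> Qu; rewrite !det_mulmx mulrAC -det_mulmx unitarymx_mulCmx //.
by rewrite det1 mul1r.
Qed.

Lemma unitary_conj_scalar_sub (C : numClosedFieldType) n (Q M : 'M[C]_n) t :
  Q \is unitarymx -> Q^t* *m (t%:M - M) *m Q = t%:M - Q^t* *m M *m Q.
Proof.
move=> Qu; rewrite mulmxBr mulmxBl mul_mx_scalar -scalemxAl.
by rewrite unitarymx_mulCmx // scalemx1.
Qed.

(** * Residues of rational functions with simple poles *)

Lemma polyfun_eq0 (C : numDomainType) (q : {poly C}) :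
  (forall t, q.[t] = 0) -> q = 0.
Proof.
move=> q0; apply/eqP/negPn/negP => q_neq0.
have q_roots : all (root q) (mkseq (fun k => k%:R) (size q)).
  by apply/allP => t _; rewrite /root q0.
have/(max_poly_roots q_neq0 q_roots) : uniq (mkseq (fun k => k%:R : C) (size q)).
  by apply: mkseq_uniq => i j /eqP; rewrite eqr_nat => /eqP.
by rewrite size_mkseq ltnn.
Qed.

(** The coefficient sums over equal poles are residues.  Clearing denominators
by the product over the distinct values of [d] turns the hypothesis into a
polynomial that vanishes off the poles, hence everywhere; its value at a pole
[l] is the residue at [l] times a nonzero product of differences. *)
Lemma partial_fractions_eq0 (C : numFieldType) n (d c : 'I_n -> C) :
  (forall t, (forall a, t != d a) -> \sum_a c a / (t - d a) = 0) ->
  forall l, \sum_(a | d a == l) c a = 0.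
Proof.
move=> c0 l; have [/codomP[a0 ->{l}] | ln] := boolP (l \in codom d); last first.
  by rewrite big1 // => a /eqP dal; rewrite -dal codom_f in ln.
set s := undup (codom d).
have d_s a : d a \in s by rewrite mem_undup codom_f.
pose q := \sum_a c a *: \prod_(m <- s | m != d a) ('X - m%:P).
have qE t : q.[t] = \sum_a c a * \prod_(m <- s | m != d a) (t - m).
  rewrite horner_sum; apply: eq_bigr => a _; rewrite hornerZ horner_prod.
  congr (_ * _); by under eq_bigr do rewrite hornerXsubC.
have q_off t : (forall a, t != d a) -> q.[t] = 0.
  move=> t_d; rewrite qE -[RHS](mulr0 (\prod_(m <- s) (t - m))).
  rewrite -[X in _ * X](c0 _ t_d) mulr_sumr; apply: eq_bigr => a _.
  rewrite (bigD1_seq (d a)) ?undup_uniq //=.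
  have tda : t - d a != 0 by rewrite subr_eq0.
  by field.
(* Multiplying [q] by the polynomial with root set [s] covers the points where
   [q_off] says nothing. *)
have q0 : q = 0.
  have /polyfun_eq0/eqP : forall t, (q * \prod_(m <- s) ('X - m%:P)).[t] = 0.
    move=> t; rewrite hornerM.
    have [/codomP[a ->] | t_d] := boolP (t \in codom d).
      rewrite horner_prod (bigD1_seq (d a)) ?undup_uniq //= hornerXsubC subrr.
      by rewrite mul0r mulr0.
    rewrite q_off ?mul0r // => a; apply: contraNneq t_d => ->; exact: codom_f.
  by rewrite mulf_eq0 (negPf (monic_neq0 (monic_prod_XsubC _ _ _))) orbF => /eqP.
(* At [d a0], the terms with another pole contain the factor [d a0 - d a0]. *)
have := qE (d a0); rewrite q0 horner0 (bigID (fun a => d a == d a0)) /=.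
rewrite [X in _ + X]big1 => [|a a_a0]; last first.
  apply/eqP; rewrite mulf_eq0 prodf_seq_eq0; apply/orP; right; apply/hasP.
  by exists (d a0); rewrite // eq_sym a_a0 subrr eqxx.
rewrite addr0 (eq_bigr (fun a => c a * \prod_(m <- s | m != d a0) (d a0 - m))).
  rewrite -mulr_suml => /esym/eqP; rewrite mulf_eq0 => /orP[/eqP //|].
  rewrite prodf_seq_eq0 => /hasP[m _ /andP[m_d]].
  by rewrite subr_eq0 eq_sym (negPf m_d).
by move=> a /eqP ->.
Qed.

(** * Determinants of rank-one perturbations *)

(** Both sides are the determinant of the bordered matrix (M u; v 1), computed
by eliminating either of its two diagonal blocks. *)
Lemma det_sub_rank1 (F : fieldType) n (M : 'M[F]_n) (u : 'cV[F]_n)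
    (v : 'rV[F]_n) : M \in unitmx ->
  \det (M - u *m v) = \det M * (1 - (v *m invmx M *m u) 0 0).
Proof.
move=> Mu.
have e1 : block_mx 1%:M u 0 1%:M *m block_mx (M - u *m v) 0 v (1%:M : 'M_1)
          = block_mx M u v 1%:M.
  by rewrite mulmx_block !mul1mx !mul0mx !mulmx1 !add0r subrK.
have e2 : block_mx M 0 v (1%:M - v *m invmx M *m u)
            *m block_mx 1%:M (invmx M *m u) 0 (1%:M : 'M_1)
          = block_mx M u v 1%:M.
  by rewrite mulmx_block !mulmx1 !mulmx0 !addr0 mulKVmx // mulmxA addrC subrK.
have := congr1 determinant (etrans e1 (esym e2)).
rewrite !det_mulmx !det_ublock !det_lblock !det1 !mul1r !mulr1 => ->.
by congr (_ * _); rewrite det_mx11 !mxE.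
Qed.

(** * Unitary matrices with prescribed values *)

Section UnitaryExtension.
Variables (C : numClosedFieldType) (n : nat) (D : 'M[C]_n).
Hypothesis D_herm : D^t* = D.

(** The complex Householder reflection [1 - z^-1 w^* w] with [w = u - v] and
[z = u w^*].  Over the complex numbers [z] need not be real, and unitarity
comes from [z + z^* = w w^*], which holds because [u] and [v] have equal norm.
It commutes with [D] since [w] is an eigenvector of [D] for a real
eigenvalue. *)
Lemma exists_reflection (mu : C) (u v : 'rV[C]_n) : mu^* = mu ->
    u *m D = mu *: u -> v *m D = mu *: v -> u *m u^t* = v *m v^t* ->
  exists W : 'M[C]_n, [/\ W \is unitarymx, W *m D = D *m W, u *m W = v
    & forall x : 'rV[C]_n, x *m (u - v)^t* = 0 -> x *m W = x].
Proof.
move=> mu_real uD vD uv; have [w wE] : exists w, w = u - v by exists (u - v).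
rewrite -wE.
have [w0 | w_neq0] := eqVneq w 0.
  exists 1%:M; split; rewrite ?mul1mx ?mulmx1 //.
  - by apply/unitarymxP; rewrite mul1mx trmx1 map_mx1.
  - by apply/eqP; rewrite -subr_eq0 -wE w0.
  - by move=> x _; rewrite mulmx1.
set z := (u *m w^t*) 0 0.
have zE : u *m w^t* = z%:M by rewrite [LHS]mx11_scalar.
have zCE : w *m u^t* = (z^*)%:M.
  by rewrite -[w]trmxCK -trmxC_mul zE tr_scalar_mx map_scalar_mx.
have wwE : w *m w^t* = (z + z^*)%:M.
  rewrite [RHS]raddfD /= -zE -zCE {1}wE mulmxBl; congr (_ + _).
  by rewrite wE trmxC_sub mulmxBr -uv opprB mulmxBl.
have zz : z + z^* != 0.
  apply: contraNneq w_neq0 => zz.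
  by rewrite -(dnorm_eq0 (@dotmx C n)) [X in X == 0]dotmxE wwE zz mxE mul0rn.
have z0 : z != 0 by apply: contraNneq zz => ->; rewrite rmorph0 addr0.
have zC0 : z^* != 0 by rewrite fmorph_eq0.
have wD : w *m D = mu *: w by rewrite wE mulmxBl uD vD -scalerBr.
have Dw : D *m w^t* = mu *: w^t*.
  by rewrite -{1}D_herm -trmxC_mul wD trmxC_scale mu_real.
exists (1%:M - z^-1 *: (w^t* *m w)); split.
- apply/unitarymxP; rewrite trmxC_sub trmxC_scale trmx1 map_mx1.
  rewrite trmxC_mul trmxCK fmorphV mulmxBl mul1mx mulmxBr mulmx1.
  rewrite -scalemxAl -scalemxAr mulmxA -(mulmxA _ w) wwE mul_mx_scalar.
  rewrite -scalemxAl !scalerA.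
  have -> : z^-1 * ((z^*)^-1 * (z + z^*)) = z^-1 + (z^*)^-1.
    by rewrite mulrCA !mulrDr mulVf // mulr1 mulrCA mulVf // mulr1 addrC.
  by rewrite scalerDl opprB [_ + _ *: _]addrC addrK subrK.
- rewrite mulmxBl mulmxBr mul1mx mulmx1 -scalemxAl -scalemxAr mulmxA Dw.
  by rewrite -mulmxA wD -scalemxAl -scalemxAr.
- rewrite mulmxBr mulmx1 -scalemxAr mulmxA zE mul_scalar_mx scalerA mulVf //.
  by rewrite scale1r wE opprB addrC subrK.
- move=> x xw; rewrite mulmxBr mulmx1 -scalemxAr mulmxA xw mul0mx.
  by rewrite scaler0 subr0.
Qed.

(** Induction on the list of vectors: the unitary [W0] matching the tail is
followed by the reflection sending [M i *m W0] to [N i].  That reflection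
fixes the vectors already placed, because equality of the Gram matrices makes
them orthogonal to [M i *m W0 - N i]. *)
Lemma exists_unitary_of_gram (I : eqType) (mu : I -> C) (M N : I -> 'rV[C]_n)
    (r : seq I) :
    (forall i, (mu i)^* = mu i) ->
    (forall i, M i *m D = mu i *: M i) -> (forall i, N i *m D = mu i *: N i) ->
    (forall i j, M i *m (M j)^t* = N i *m (N j)^t*) ->
  exists W : 'M[C]_n, [/\ W \is unitarymx, W *m D = D *m W
    & {in r, forall i, M i *m W = N i}].
Proof.
move=> mu_real MD ND MN; elim: r => [|i r [W0 [W0u W0D W0r]]].
  exists 1%:M; split; rewrite ?mul1mx ?mulmx1 //.
  by apply/unitarymxP; rewrite mul1mx trmx1 map_mx1.
have [||||W1 [W1u W1D W1i W1fix]] :=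
    @exists_reflection (mu i) (M i *m W0) (N i); rewrite ?mu_real ?ND //.
- by rewrite -mulmxA W0D mulmxA MD scalemxAl.
- by rewrite trmxC_mul mulmxA (mulmxtVK _ W0u) MN.
exists (W0 *m W1); split; first exact: mul_unitarymx.
  by rewrite -mulmxA W1D mulmxA W0D mulmxA.
move=> j; rewrite in_cons mulmxA => /predU1P[-> // | jr].
rewrite W0r // W1fix // trmxC_sub mulmxBr -{1}(W0r j jr) trmxC_mul mulmxA.
by rewrite (mulmxtVK _ W0u) MN subrr.
Qed.

End UnitaryExtension.

(** * Two families of vectors over the same diagonal matrix *)

Lemma scalar_mx_sub_diag (F : pzRingType) n (d : 'rV[F]_n) (t : F) :
  t%:M - diag_mx d = diag_mx (\row_a (t - d 0 a)).
Proof. by apply/matrixP => a b; rewrite !mxE -mulrnBl. Qed.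

Lemma det_diag_sub_rank1 (F : fieldType) n (d : 'rV[F]_n) (u : 'cV[F]_n)
    (v : 'rV[F]_n) (t : F) : (forall a, t != d 0 a) ->
  \det (t%:M - diag_mx d - u *m v)
    = \det (t%:M - diag_mx d) * (1 - \sum_a v 0 a * u a 0 / (t - d 0 a)).
Proof.
move=> td; set M := t%:M - diag_mx d.
pose R : 'M[F]_n := diag_mx (\row_a (t - d 0 a)^-1).
have MR : M *m R = 1%:M.
  rewrite /M scalar_mx_sub_diag mulmx_diag; apply/matrixP => a b; rewrite !mxE.
  by rewrite mulfV ?subr_eq0.
have [Mu _] := mulmx1_unit MR.
rewrite det_sub_rank1 //; congr (_ * (1 - _)).
have -> : invmx M = R by rewrite -[RHS](mulKmx Mu) MR mulmx1.
rewrite mul_mx_diag mxE; apply: eq_bigr => a _; rewrite !mxE.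
by rewrite mulrAC.
Qed.

(** The orthogonal projection of [z] on the eigenspace of [diag_mx d] for
[l], which is [0] when [l] is not an entry of [d]. *)
Definition level_part (C : numClosedFieldType) n (d : 'rV[C]_n) (l : C)
  (z : 'rV[C]_n) : 'rV[C]_n := \row_a (z 0 a *+ (d 0 a == l)).

Lemma level_part_eigen (C : numClosedFieldType) n (d : 'rV[C]_n) l z :
  level_part d l z *m diag_mx d = l *: level_part d l z.
Proof.
apply/rowP => a; rewrite mul_mx_diag !mxE.
by case: eqP => [->|]; rewrite ?mulr0n ?mulr0 ?mul0r // mulrC.
Qed.

Lemma sum_level_part (C : numClosedFieldType) n (d z : 'rV[C]_n) :
  z = \sum_(l <- undup (codom (d 0))) level_part d l z.
Proof.
apply/rowP => a; rewrite summxE (bigD1_seq (d 0 a)) ?undup_uniq //=; last first.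
  by rewrite mem_undup; exact: codom_f.
rewrite big1 => [|l la]; rewrite mxE ?eqxx ?addr0 //.
by rewrite eq_sym (negPf la).
Qed.

(** Projections on distinct eigenspaces are orthogonal, so the Gram matrix of
all the projections of a family is determined by its diagonal blocks, one for
each eigenvalue. *)
Lemma level_part_gram (C : numClosedFieldType) n (d : 'rV[C]_n) l m z w :
  level_part d l z *m (level_part d m w)^t* =
  ((\sum_(a | d 0 a == l) z 0 a * (w 0 a)^*) *+ (l == m))%:M.
Proof.
rewrite [LHS]mx11_scalar; congr (_%:M); rewrite mxE -sumrMnl [RHS]big_mkcond.
apply: eq_bigr => a _; rewrite !mxE; case: eqP => [->|].
  by case: eqP => _; rewrite ?mulr1n // mulr0n rmorph0 mulr0.
by rewrite mulr0n mul0r.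
Qed.

(** Off the spectrum the determinants give the resolvent entries
[\sum_a z_j a * (z_i a)^* / (t - d a)], whose residues are the Gram matrices of
the projections on the eigenspaces; here [z]
stands for [x] or [y].  Matching the projections with
[exists_unitary_of_gram] matches the vectors, which are the sums of their
projections. *)
Lemma diagonal_intertwiner (C : numClosedFieldType) n (I : finType)
    (d : 'rV[C]_n) (x y : I -> 'rV[C]_n) :
    (forall a, (d 0 a)^* = d 0 a) ->
    (forall i j t, (forall a, t != d 0 a) ->
       \det (t%:M - diag_mx d - (x i)^t* *m x j)
       = \det (t%:M - diag_mx d - (y i)^t* *m y j)) ->
  exists W : 'M[C]_n, [/\ W \is unitarymx, W *m diag_mx d = diag_mx d *m W
    & forall i, x i *m W = y i].
Proof.
move=> d_real det_xy.
have level_gram l i j :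
    \sum_(a | d 0 a == l) x i 0 a * (x j 0 a)^*
    = \sum_(a | d 0 a == l) y i 0 a * (y j 0 a)^*.
  apply/eqP; rewrite -subr_eq0 -sumrB; apply/eqP.
  apply: (@partial_fractions_eq0 _ _ (fun a => d 0 a)) => t td.
  have := det_xy j i t td; rewrite !det_diag_sub_rank1 //.
  have dt : \det (t%:M - diag_mx d) != 0.
    rewrite scalar_mx_sub_diag det_diag; apply/prodf_neq0 => a _.
    by rewrite mxE subr_eq0.
  move=> /(mulfI dt)/addrI/oppr_inj xy.
  under eq_bigr do rewrite mulrBl.
  rewrite sumrB; apply/eqP; rewrite subr_eq0; apply/eqP.
  move: xy; congr (_ = _); by apply: eq_bigr => a _; rewrite !mxE.
have part_gram k1 k2 :
    level_part d (d 0 k1.1) (x k1.2) *m (level_part d (d 0 k2.1) (x k2.2))^t*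
    = level_part d (d 0 k1.1) (y k1.2) *m (level_part d (d 0 k2.1) (y k2.2))^t*.
  by rewrite !level_part_gram level_gram.
have diag_herm : (diag_mx d)^t* = diag_mx d.
  rewrite tr_diag_mx map_diag_mx; congr diag_mx.
  by apply/rowP => a; rewrite mxE; exact: d_real.
(* Eigenvalues are indexed by their positions in [d]: a multiple eigenvalue
   only repeats the same requirement on [W]. *)
have [||||W [Wu WD Wpart]] := @exists_unitary_of_gram _ _ _ diag_herm
  ('I_n * I)%type (fun k => d 0 k.1) (fun k => level_part d (d 0 k.1) (x k.2))
  (fun k => level_part d (d 0 k.1) (y k.2)) (enum {: 'I_n * I}) => //.
- by move=> k; exact: level_part_eigen.
- by move=> k; exact: level_part_eigen.
exists W; split => // i.
rewrite (sum_level_part d (x i)) (sum_level_part d (y i)) mulmx_suml.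
apply: eq_big_seq => l; rewrite mem_undup => /codomP[a ->].
by have := Wpart (a, i); rewrite mem_enum /=; apply.
Qed.
(** * Unitary equivalence of Hermitian matrices with marked vectors *)

Lemma hermitian_diagonalization (C : numClosedFieldType) n (B : 'M[C]_n) :
    B^t* = B ->
  exists (V : 'M[C]_n) (d : 'rV[C]_n), [/\ V \is unitarymx,
    B = V^t* *m diag_mx d *m V
    & forall a, (d 0 a)^* = d 0 a].
Proof.
move=> BH; have B_herm : B \is hermsymmx.
  by apply/is_hermitianmxP; rewrite expr0 scale1r BH.
exists (spectralmx B), (spectral_diag B); split.
- exact: spectral_unitarymx.
- rewrite -invmx_unitary ?spectral_unitarymx //.
  exact/orthomx_spectralP/hermitian_normalmx.
- move=> a; apply/CrealP.
  by move/hermitian_spectral_diag_real/mxOverP : B_herm => /(_ 0 a).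
Qed.

(** Equal characteristic polynomials have the same roots with multiplicity, so
the two spectra differ by a permutation, which can be absorbed in the unitary
matrix diagonalizing [B]. *)
Lemma hermitian_diagonalization_common (C : numClosedFieldType) n
    (A B : 'M[C]_n) : A^t* = A -> B^t* = B ->
    (forall t, \det (t%:M - A) = \det (t%:M - B)) ->
  exists (U V : 'M[C]_n) (d : 'rV[C]_n), [/\ U \is unitarymx, V \is unitarymx,
    A = U^t* *m diag_mx d *m U, B = V^t* *m diag_mx d *m V
    & forall a, (d 0 a)^* = d 0 a].
Proof.
move=> AH BH AB.
have [U [d [Uu AE d_real]]] := hermitian_diagonalization AH.
have [V [f [Vu BE f_real]]] := hermitian_diagonalization BH.
have detE (Q : 'M[C]_n) (g : 'rV[C]_n) t : Q \is unitarymx ->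
    \det (t%:M - Q^t* *m diag_mx g *m Q)
    = (\prod_(l <- [tuple g 0 a | a < n]) ('X - l%:P)).[t].
  move=> Qu; rewrite -unitary_conj_scalar_sub // det_unitary_conj //.
  rewrite scalar_mx_sub_diag det_diag horner_prod big_map big_enum /=.
  by apply: eq_bigr => a _; rewrite mxE hornerXsubC.
have /prod_XsubC_eq/tuple_permP[s ds] :
    \prod_(l <- [tuple d 0 a | a < n]) ('X - l%:P)
    = \prod_(l <- [tuple f 0 a | a < n]) ('X - l%:P).
  apply/eqP; rewrite -subr_eq0; apply/eqP; apply: polyfun_eq0 => t.
  by rewrite hornerD hornerN -(detE U) // -(detE V) // -AE -BE AB subrr.
have dE a : d 0 a = f 0 (s a).
  have /val_inj/(congr1 (fun u => tnth u a)) := ds.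
  by rewrite !tnth_mktuple.
exists U, (row_perm s V), d; split => //.
  rewrite row_permE mul_unitarymx //; apply/unitarymxP.
  by rewrite tr_perm_mx map_perm_mx -perm_mxM mulgV perm_mx1.
rewrite BE; apply/matrixP => i j; rewrite !mul_mx_diag !mxE.
rewrite (reindex_inj (@perm_inj _ s)); apply: eq_bigr => a _.
by rewrite !mxE dE.
Qed.

(** With [A = U^* D U] and [B = V^* D V], the coordinates of the vectors in the
two eigenbases are intertwined by some [W] commuting with [D], and
[Q = U^* W V] transports this back. *)
Lemma hermitian_unitary_equiv (C : numClosedFieldType) n (I : finType)
    (A B : 'M[C]_n) (e : I -> 'cV[C]_n) : A^t* = A -> B^t* = B ->
    (forall t, \det (t%:M - A) = \det (t%:M - B)) ->
    (forall i j t, \det (t%:M - (A + e i *m (e j)^t*))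
                   = \det (t%:M - (B + e i *m (e j)^t*))) ->
  exists Q : 'M[C]_n, [/\ Q \is unitarymx, Q^t* *m A *m Q = B
    & forall i, Q^t* *m e i = e i].
Proof.
move=> AH BH AB ABe.
have [U [V [d [Uu Vu AE BE d_real]]]] :=
  hermitian_diagonalization_common AH BH AB.
have detE (Q : 'M[C]_n) i j t : Q \is unitarymx ->
    \det (t%:M - (Q^t* *m diag_mx d *m Q + e i *m (e j)^t*))
    = \det (t%:M - diag_mx d - ((e i)^t* *m Q^t*)^t* *m ((e j)^t* *m Q^t*)).
  move=> Qu; rewrite -[RHS](det_unitary_conj _ Qu) -addrA -opprD.
  rewrite unitary_conj_scalar_sub // mulmxDr mulmxDl trmxC_mul !trmxCK.
  by rewrite !mulmxA unitarymx_mulCmx // mul1mx mulmxKtV.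
have [|W [Wu WD We]] := @diagonal_intertwiner C n I d
    (fun i => (e i)^t* *m U^t*) (fun i => (e i)^t* *m V^t*) d_real.
  by move=> i j t _; rewrite -!detE // -AE -BE ABe.
exists (U^t* *m W *m V); split.
- by rewrite !mul_unitarymx // trmxC_unitary.
- rewrite !trmxC_mul trmxCK AE BE !mulmxA (mulmxtVK _ Uu) (mulmxtVK _ Uu).
  by rewrite -(mulmxA _ _ W) -WD mulmxA (mulmxKtV _ Wu) .
- move=> i; rewrite -[RHS]trmxCK -[in LHS](trmxCK (e i)) -trmxC_mul.
  by congr (_^t*); rewrite !mulmxA We mulmxKtV.
Qed.

(** * The pencils of digraphs *)

Lemma trmxC_hermitian_adj (C : numClosedFieldType) (V : finType)
  (G : digraph V) : (hermitian_adj C G)^t* = hermitian_adj C G.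
Proof.
apply/matrixP => a b; rewrite !mxE /=.
by do 2!case: ifP => _; rewrite ?rmorphN /= ?conjCi ?opprK ?rmorph1 ?rmorph0.
Qed.

Lemma trmxC_char_vec (C : numClosedFieldType) (V : finType) (S : {set V}) :
  (char_vec C S)^t* = (char_vec C S)^T.
Proof. by apply/matrixP => a b; rewrite !mxE conjC_nat. Qed.

Section ExtendedTuple.
Variables (C : numClosedFieldType) (n p : nat) (e : 'I_p -> 'cV[C]_n).

Lemma lin_pencil_extended_scalar (M : 'M[C]_n) :
  lin_pencil (extended_tuple M e) [tuple (l == ord0)%:R | l < 1 + p ^ 2] = M.
Proof.
rewrite /lin_pencil (bigD1 ord0) //= big1 => [|l l0].
  by rewrite tnth_mktuple eqxx scale1r addr0.
by rewrite tnth_mktuple (negPf l0) scale0r.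
Qed.

(** The same coefficients [s] have to serve both digraphs.  The position of
[J_(i,j)] is found in the tail of the tuple, which does not depend on the
first matrix. *)
Lemma exists_pencil_rank1 (i j : 'I_p) :
  exists s : (1 + p ^ 2).-tuple C, forall M : 'M[C]_n,
    lin_pencil (extended_tuple M e) s = M + e i *m (e j)^T.
Proof.
pose J := [seq e i *m (e j)^T | i <- enum 'I_p, j <- enum 'I_p].
have J_ij : e i *m (e j)^T \in J by apply: allpairs_f; rewrite mem_enum.
have szJ : size J = (p ^ 2)%N by rewrite size_allpairs size_enum_ord.
have lt_ij : ((index (e i *m (e j)^T) J).+1 < 1 + p ^ 2)%N.
  by rewrite add1n ltnS -szJ index_mem.
pose l0 := Ordinal lt_ij.
exists [tuple ((l == ord0) || (l == l0))%:R | l < 1 + p ^ 2] => M.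
rewrite /lin_pencil (bigD1 ord0) //= (bigD1 l0) //= big1 => [|l]; last first.
  by rewrite tnth_mktuple => /andP[/negPf-> /negPf->]; rewrite scale0r.
rewrite !tnth_mktuple !eqxx orbT !scale1r addr0; congr (_ + _).
by rewrite (tnth_nth 0) /= nth_index.
Qed.

(** As the [e i] are real, [Q^* e_i = e_i] also gives [e_i^T Q = e_i^T], so that
conjugation by [Q] fixes every [J_(i,j)]. *)
Lemma similar_via_extended (M N Q : 'M[C]_n) :
    Q^t* *m M *m Q = N -> (forall i, Q^t* *m e i = e i) ->
    (forall i, (e i)^t* = (e i)^T) ->
  similar_via (extended_tuple M e) (extended_tuple N e) Q.
Proof.
move=> MN Qe e_real s; rewrite /lin_pencil mulmx_sumr mulmx_suml.
have eQ i : (e i)^T *m Q = (e i)^T.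
  by rewrite -e_real -{2}(Qe i) trmxC_mul trmxCK.
apply: eq_bigr => l _; rewrite -scalemxAr -scalemxAl; congr (_ *: _).
have -> : extended_tuple N e
          = [tuple of map (fun X => Q^t* *m X *m Q) (extended_tuple M e)].
  apply: val_inj; rewrite /= MN map_allpairs; congr (_ :: _).
  by apply: eq_allpairs => i j; rewrite -!mulmxA eQ !mulmxA Qe.
by rewrite tnth_map.
Qed.

Lemma mulmx_walk_matrix (M N Q : 'M[C]_n) :
    Q \is unitarymx -> Q^t* *m M *m Q = N -> (forall i, Q^t* *m e i = e i) ->
  Q^t* *m walk_matrix M e = walk_matrix N e.
Proof.
move=> Qu <- Qe; have walk m i : Q^t* *m (M ^+ m *m e i)
    = (Q^t* *m M *m Q) ^+ m *m e i.
  elim: m => [|m IHm]; first by rewrite !expr0 !mul1mx Qe.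
  by rewrite !exprS -!mulmxE -[RHS]mulmxA -IHm !mulmxA (mulmxtVK _ Qu).
rewrite /walk_matrix mul_mxrow; apply: eq_mxrow => i.
apply/matrixP => a m; rewrite [RHS]mxE -walk !mxE.
by apply: eq_bigr => b _; rewrite !mxE.
Qed.

End ExtendedTuple.

Theorem theorem1p4 (R : realType) (V : finType) (G H : digraph V) (p : nat)
    (Vs : 'I_p -> {set V})
    (Vs_disjoint : forall i j : 'I_p, i != j -> [disjoint Vs i & Vs j]) :
  let A1 : 'M[R[i]]_#|V| := hermitian_adj R[i] G in
  let B1 : 'M[R[i]]_#|V| := hermitian_adj R[i] H in
  let e : 'I_p -> 'cV[R[i]]_#|V| := fun i => char_vec R[i] (Vs i) in
  let A : (1 + p ^ 2).-tuple 'M[R[i]]_#|V| := extended_tuple A1 e in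
  let B : (1 + p ^ 2).-tuple 'M[R[i]]_#|V| := extended_tuple B1 e in
  let good (Q : 'M[R[i]]_#|V|) : Prop :=
    [/\ Q \is unitarymx,
        similar_via A B Q,
        Q ^t* *m A1 *m Q = B1
      & forall i : 'I_p, Q ^t* *m e i = e i] in
  ((forall (s : (1 + p ^ 2).-tuple R[i]) (t : R[i]),
      pencil_char_poly A s t = pencil_char_poly B s t)
    <-> (exists Q : 'M[R[i]]_#|V|, good Q))
  /\ (forall Q : 'M[R[i]]_#|V|,
        good Q -> Q ^t* *m walk_matrix A1 e = walk_matrix B1 e).
Proof.
move=> A1 B1 e A B good; split; last first.
  by move=> Q [Qu _ QA Qe]; exact: mulmx_walk_matrix.
have e_real i : (e i)^t* = (e i)^T by exact: trmxC_char_vec.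
split=> [AB | [Q [Qu QAB _ _]] s t]; last first.
  rewrite /pencil_char_poly -QAB -unitary_conj_scalar_sub //.
  by rewrite det_unitary_conj.
have [t | i j t | Q [Qu QA Qe]] :=
    @hermitian_unitary_equiv _ _ _ A1 B1 e (trmxC_hermitian_adj _ G)
      (trmxC_hermitian_adj _ H).
- have := AB [tuple (l == ord0)%:R | l < 1 + p ^ 2] t.
  by rewrite /pencil_char_poly !lin_pencil_extended_scalar.
- have [s sE] := exists_pencil_rank1 e i j.
  by have := AB s t; rewrite /pencil_char_poly !sE e_real.
by exists Q; split => //; exact: similar_via_extended.
Qed.
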